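(* Let $K$ be a field, let $r\ge2$, and let $I$ be the edge ideal (over $K$) of a simple $r$-partite hypergraph. Then, for every integer $k\ge1$: (i) $\overline{I^{(r-1)(k-1)+1}}\subseteq I^k$ (integral closure of the ordinary power with exponent $(r-1)(k-1)+1$); (ii) $I^{\left(\lceil\frac12r(k-1)\rceil+1\right)}\subseteq\overline{I^k}$ (the left side being a symbolic power).
   Context: A hypergraph consists of a finite vertex set (here $\{1,\dots,n\}$) and a collection of nonempty subsets of it, called edges; it is simple if no edge is properly contained in another. It is $r$-partite if its vertex set can be partitioned into $r$ parts such that no edge contains two vertices from the same part. The edge ideal is the squarefree monomial ideal of $K[x_1,\dots,x_n]$ generated by $\prod_{i\in F}x_i$ for edges $F$. $\overline J$ is the integral closure of an ideal $J$. The $h$-th symbolic power $I^{(h)}$ of a squarefree monomial ideal $I$ is $\bigcap_{P\in\mathrm{Min}(I)}P^h$, with $\mathrm{Min}(I)$ the set of minimal primes of $I$. *)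

(* Defs.v *)
From mathcomp Require Import all_boot all_order all_algebra.
From mathcomp Require Import classical_sets.
From mathcomp Require Import mpoly.

Set Implicit Arguments.
Unset Strict Implicit.
Unset Printing Implicit Defensive.

Import GRing.Theory.

Definition hypergraph (n : nat) (E : {set {set 'I_n}}) : Prop :=
  forall F, F \in E -> F <> finset.set0.

Definition simple_hypergraph (n : nat) (E : {set {set 'I_n}}) : Prop :=
  forall F G, F \in E -> G \in E -> ~~ (F \proper G).

(* The parts are allowed to be empty, as usual for r-partite (hyper)graphs. *)
Definition partite (n r : nat) (E : {set {set 'I_n}}) : Prop :=
  exists V : 'I_r -> {set 'I_n},
    [/\ forall i j, i != j -> [disjoint V i & V j],
        forall v, exists i, v \in V i
      & forall F i, F \in E -> (#|F :&: V i| <= 1)%N].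

Local Open Scope ring_scope.
Local Open Scope classical_set_scope.

(* Ideals are Prop-valued sets rather than boolean predicates (as in
   ring_quotient), so that the minimal primes below range over all primes
   and not only over the decidable ones. *)

Definition is_ideal (R : comNzRingType) (J : set R) : Prop :=
  [/\ J 0, forall x y, J x -> J y -> J (x + y)
    & forall a x, J x -> J (a * x)].

Definition ideal_gen (R : comNzRingType) (S : set R) : set R :=
  smallest (@is_ideal R) S.

Definition ideal_pow (R : comNzRingType) (J : set R) (h : nat) : set R :=
  ideal_gen [set y | exists f : 'I_h -> R,
                       (forall i, J (f i)) /\ y = \prod_(i < h) f i].

Definition prime_ideal (R : comNzRingType) (P : set R) : Prop :=
  [/\ is_ideal P, ~ P 1 & forall x y, P (x * y) -> P x \/ P y].

Definition minimal_primes (R : comNzRingType) (J : set R) : set (set R) :=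
  [set P | [/\ prime_ideal P, J `<=` P
             & forall Q, prime_ideal Q -> J `<=` Q -> Q `<=` P -> Q = P]].

Definition integral_closure (R : comNzRingType) (J : set R) : set R :=
  [set x | exists (d : nat) (a : nat -> R),
     [/\ (0 < d)%N,
         forall i, (0 < i <= d)%N -> ideal_pow J i (a i)
       & x ^+ d + \sum_(1 <= i < d.+1) a i * x ^+ (d - i) = 0]].

Definition symbolic_power (R : comNzRingType) (J : set R) (h : nat) : set R :=
  \bigcap_(P in minimal_primes J) ideal_pow P h.

Definition edge_ideal (K : fieldType) (n : nat) (E : {set {set 'I_n}}) :
    set {mpoly K[n]} :=
  ideal_gen [set p | exists2 F, F \in E & p = \prod_(i in F) 'X_i].

Arguments edge_ideal K {n} E.

(* Main.v *)
(* For an exponent vector [u], [x^u] lies in the integral closure of [I^k] iff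
   the linear program "minimise t.u over fractional covers t" has value at
   least [k], by LP duality and clearing of denominators.

   (i) Orders with respect to monomial weights are valuations, so every
   exponent [u] of an element of the closure of [I^h] has LP value at least
   [h]. Fueredi's argument for [r]-partite hypergraphs shows that some edge can
   be removed from [u] while the value drops by at most [r - 1]; hence a value
   of at least [(r-1)(k-1)+1] yields [k] edges whose product divides [x^u].

   (ii) The ideals generated by the variables of minimal vertex covers are
   minimal primes, so an exponent [u] of an element of a symbolic power
   [I^(h)] satisfies u(C) >= h for all covers [C]. Given a fractional cover
   [t], a derandomised form of Lovasz' threshold rounding gives t.u >= k. *)

From HB Require Import structures.
Require Import Defs.
From mathcomp Require Import all_boot all_order all_algebra.
From mathcomp Require Import boolp classical_sets.
From mathcomp Require Import mpoly.
From mathcomp Require Import ring lra zify.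

Set Implicit Arguments.
Unset Strict Implicit.
Unset Printing Implicit Defensive.

Import Order.TTheory GRing.Theory Num.Theory.
Local Open Scope ring_scope.

(** * Linear programming *)

(* The induction on the number of generators is due to Bartl: a functional
   [y0] separating [b] from all generators but [g a] is used to project
   everything along [g a]. *)
Lemma farkas (R : realFieldType) (V I : finType) (r : seq I) (g : I -> V -> R)
    (b : V -> R) :
  uniq r ->
  (exists l : I -> R, (forall i, 0 <= l i) /\
     forall v, b v = \sum_(i <- r) l i * g i v) \/
  (exists y : V -> R, (forall i, i \in r -> 0 <= \sum_v g i v * y v) /\
     \sum_v b v * y v < 0).
Proof.
elim: r g b => [|a r IH] g b.
  move=> _; case: (pselect (forall v, b v = 0)) => [b0|].
    by left; exists (fun=> 0); split=> // v; rewrite big_nil.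
  move/existsNP => [v /eqP bv].
  right; exists (fun u => - b u); split=> //.
  rewrite (eq_bigr (fun u => - (b u ^+ 2))); last by move=> u _; ring.
  rewrite sumrN oppr_lt0 (bigD1 v) //= ltr_wpDr ?sumr_ge0 // => [u _|].
    exact: sqr_ge0.
  by rewrite lt_def sqr_ge0 andbT expf_neq0.
case/andP=> ar ur.
case: (IH g b ur) => [[l [l0 lb]]|[y0 [y0g y0b]]].
  left; exists (fun i => if i == a then 0 else l i); split=> [i|v].
    by case: ifP.
  rewrite big_cons eqxx mul0r add0r lb; apply: eq_big_seq => i ir.
  by case: eqP => // ia; rewrite -ia ir in ar.
set d := fun (x y : V -> R) => \sum_v x v * y v.
have dBl x z c y : d (fun v => x v - c * z v) y = d x y - c * d z y.
  by rewrite /d mulr_sumr -sumrB; apply: eq_bigr => v _; ring.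
have dBr x z c y : d x (fun v => y v - c * z v) = d x y - c * d x z.
  by rewrite /d mulr_sumr -sumrB; apply: eq_bigr => v _; ring.
have [ga|ga] := leP 0 (d (g a) y0).
  by right; exists y0; split=> // i; rewrite inE => /predU1P[->|/y0g].
have ga0 : d (g a) y0 != 0 by rewrite lt_eqF.
pose g' i v := g i v - d (g i) y0 / d (g a) y0 * g a v.
pose b' v := b v - d b y0 / d (g a) y0 * g a v.
case: (IH g' b' ur) => [[l [l0 lb]]|[y [yg yb]]].
  left.
  pose c := d b y0 / d (g a) y0 - \sum_(i <- r) l i * (d (g i) y0 / d (g a) y0).
  exists (fun i => if i == a then c else l i); split=> [i|v].
    case: ifP => // _; rewrite subr_ge0 (@le_trans _ _ 0) //.
      rewrite big_seq sumr_le0 // => j jr; rewrite mulr_ge0_le0 //.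
      by rewrite mulr_ge0_le0 ?invr_le0 ?(ltW ga) //; apply: y0g.
    by rewrite mulr_le0 ?invr_le0 ?(ltW ga) // ltW.
  rewrite big_cons eqxx.
  rewrite (_ : \sum_(j <- r) _ = \sum_(j <- r) l j * g j v); last first.
    apply: eq_big_seq => i ir.
    by case: eqP => // ia; rewrite -ia ir in ar.
  have := lb v; rewrite /b' => /eqP; rewrite subr_eq => /eqP ->.
  have -> : \sum_(i <- r) l i * g' i v = \sum_(i <- r) l i * g i v -
      (\sum_(i <- r) l i * (d (g i) y0 / d (g a) y0)) * g a v.
    by rewrite mulr_suml -sumrB; apply: eq_bigr => i _; rewrite /g'; ring.
  by rewrite /c; ring.
right; exists (fun v => y v - d (g a) y / d (g a) y0 * y0 v).
split=> [i|]; rewrite -/(d _ _) dBr.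
  rewrite inE => /predU1P[->|ir]; first by rewrite divfK ?subrr.
  have := yg i ir; rewrite -/(d _ _) dBl; congr (_ <= _ - _).
  by rewrite mulrAC [RHS]mulrAC [X in X / _]mulrC.
have := yb; rewrite -/(d _ _) dBl; congr (_ - _ < _).
by rewrite mulrAC [RHS]mulrAC [X in X / _]mulrC.
Qed.

(** The vectors indexed by [S] form the rows of a matrix, which independence makes row free. If the
    matrix is square, it is invertible and its kernel is trivial. *)
Lemma independent_card (R : realFieldType) (J V : finType) (g : J -> V -> R)
    (S : {set J}) :
  (forall z : J -> R, (forall j, j \notin S -> z j = 0) ->
     (forall v, \sum_j z j * g j v = 0) -> forall j, z j = 0) ->
  (#|S| <= #|V|)%N /\
  (#|S| = #|V| -> forall y : V -> R,
     (forall j, j \in S -> \sum_v g j v * y v = 0) -> forall v, y v = 0).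
Proof.
move=> ind.
pose A := \matrix_(i < #|S|, k < #|V|) g (enum_val i) (enum_val k).
have Afree : row_free A.
  apply: inj_row_free => x xA.
  have [S0|[j0 j0S]] := set_0Vmem S.
    by apply/rowP => i; have := enum_valP i; rewrite {2}S0 inE.
  pose z' j := if j \in S then x 0 (enum_rank_in j0S j) else 0.
  have z'0 j : z' j = 0.
    apply: ind => [k kS|v]; first by rewrite /z' (negPf kS).
    have := congr1 (fun M : 'rV_#|V| => M 0 (enum_rank v)) xA.
    rewrite !mxE => {2}<-.
    rewrite (bigID (mem S)) /= [X in _ + X]big1 ?addr0; last first.
      by move=> k kS; rewrite /z' (negPf kS) mul0r.
    rewrite big_enum_val /=; apply: eq_bigr => i _.
    by rewrite mxE enum_rankK /z' enum_valP enum_valK_in.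
  apply/rowP => i; rewrite mxE -(z'0 (enum_val i)) /z' enum_valP.
  by rewrite enum_valK_in.
split; first by rewrite -(eqP Afree) rank_leq_col.
move=> SV y yS v.
have Afull : row_full A by rewrite /row_full (eqP Afree) SV.
have [B BA] := row_fullP Afull.
pose Y := \col_(k < #|V|) y (enum_val k).
have AY : A *m Y = 0.
  apply/colP => i; rewrite !mxE -[RHS](yS (enum_val i)) ?enum_valP //.
  rewrite (reindex (@enum_val V V)) /=; last exact/onW_bij/enum_val_bij.
  by apply: eq_bigr => k _; rewrite !mxE.
have : Y = 0 by rewrite -[Y]mul1mx -BA -mulmxA AY mulmx0.
by move/colP/(_ (enum_rank v)); rewrite !mxE enum_rankK.
Qed.

(** While the support of [p] carries a linear dependence [z], moving along [z], signed so as not to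
    lower the cost, kills a coordinate. The vectors [g j] in the support are nonnegative and
    nonzero, so [z] has a negative entry and the move is bounded. *)
Lemma basic_solution (R : realFieldType) (J V : finType) (g : J -> V -> R)
    (c p : J -> R) :
  (forall j v, 0 <= g j v) -> (forall j, p j != 0 -> exists v, 0 < g j v) ->
  (forall j, 0 <= p j) ->
  exists p' : J -> R,
    [/\ forall j, 0 <= p' j, forall j, p j = 0 -> p' j = 0,
        forall v, \sum_j p' j * g j v = \sum_j p j * g j v,
        \sum_j c j * p j <= \sum_j c j * p' j
      & forall z : J -> R, (forall j, p' j = 0 -> z j = 0) ->
          (forall v, \sum_j z j * g j v = 0) -> forall j, z j = 0].
Proof.
move=> g0; have [m] := ubnP #|[set j | p j != 0]|.
elim: m p => // m IH p pm gp p0.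
have [ind|] := pselect (forall z : J -> R, (forall j, p j = 0 -> z j = 0) ->
  (forall v, \sum_j z j * g j v = 0) -> forall j, z j = 0); first by exists p.
move=> /existsNP[z0 /not_implyP[z0p /not_implyP[z0g /existsNP[j0 /eqP z0j0]]]].
have [z [zp zg zj0 cz]] : exists z : J -> R, [/\ forall j, p j = 0 -> z j = 0,
    forall v, \sum_j z j * g j v = 0, z j0 != 0 & 0 <= \sum_j c j * z j].
  have [cz|cz] := leP 0 (\sum_j c j * z0 j); first by exists z0.
  exists (fun j => - z0 j); split=> [j /z0p ->|v||]; rewrite ?oppr0 ?oppr_eq0 //.
    by under eq_bigr do rewrite mulNr; rewrite sumrN z0g oppr0.
  by under eq_bigr do rewrite mulrN; rewrite sumrN oppr_ge0 ltW.
have pneq j : z j != 0 -> p j != 0 by apply: contra_neq; apply: zp.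
have [j1 j1z] : exists j, z j < 0.
  apply: contrapT => /forallNP zge0.
  have z_ge0 j : 0 <= z j by rewrite leNgt; apply/negP/zge0.
  have [v gv] := gp _ (pneq _ zj0).
  have := zg v; rewrite (bigD1 j0) //= => /eqP; apply/negP.
  rewrite gt_eqF // ltr_wpDr ?sumr_ge0 // => [j _|]; first exact: mulr_ge0.
  by apply: mulr_gt0; rewrite // lt_def zj0 z_ge0.
(* Ratio test: [e] is the longest step that keeps every coordinate nonnegative, and it annihilates
   coordinate [j2]. *)
case: (@Order.TotalTheory.arg_minP _ R J j1 (fun j => z j < 0) (fun j => p j / - z j) j1z) => j2 j2z j2min.
pose e := p j2 / - z j2; pose q j := p j + e * z j.
have e0 : 0 <= e by rewrite divr_ge0 // oppr_ge0 ltW.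
have q0 j : 0 <= q j.
  rewrite /q; have [zj|zj] := ltP (z j) 0; last first.
    by apply: addr_ge0 => //; apply: mulr_ge0.
  by have := j2min j zj; rewrite ler_pdivlMr ?oppr_gt0 // mulrN lerNl -subr_ge0 opprK addrC.
have pq j : p j = 0 -> q j = 0 by move=> pj; rewrite /q pj zp // mulr0 addr0.
have qj2 : q j2 = 0.
  by rewrite /q /e invrN mulrN mulNr divfK ?subrr // lt_eqF.
have [|||r [r0 qr rg rc rind]] := IH q.
- rewrite -ltnS (leq_trans _ pm) // ltnS proper_card //; apply/properP; split.
    by apply/fintype.subsetP => j; rewrite !inE; apply: contra_neq; apply: pq.
  by exists j2; rewrite !inE ?qj2 ?eqxx // pneq // lt_eqF.
- by move=> j qj; apply: gp; apply: contra_neq qj; apply: pq.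
- exact: q0.
exists r; split=> // [j /pq/qr //|v|].
  have -> : \sum_j p j * g j v = \sum_j p j * g j v + e * \sum_j z j * g j v.
    by rewrite zg mulr0 addr0.
  by rewrite rg mulr_sumr -big_split /=; apply: eq_bigr => j _; rewrite /q; ring.
apply: le_trans rc; rewrite -subr_ge0 -sumrB.
rewrite (eq_bigr (fun j => e * (c j * z j))); last by move=> j _; rewrite /q; ring.
by rewrite -mulr_sumr mulr_ge0.
Qed.

(** * Fractional covers, fractional packings and their duality *)

Section FractionalCovers.

Variables (n : nat) (E : {set {set 'I_n}}).

Definition fractional_cover (t : 'I_n -> rat) : Prop :=
  (forall v, 0 <= t v) /\ forall F, F \in E -> 1 <= \sum_(v in F) t v.

(** [M] is a lower bound for the optimum, which itself never has to be computed. *)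
Definition cover_value (u : 'I_n -> nat) (M : rat) : Prop :=
  forall t, fractional_cover t -> M <= \sum_v t v * (u v)%:R.

Definition fractional_packing (u : 'I_n -> nat) (w : {set 'I_n} -> rat) : Prop :=
  [/\ forall F, 0 <= w F, forall F, F \notin E -> w F = 0
    & forall v, \sum_(F : {set 'I_n} | v \in F) w F <= (u v)%:R].

(** Strong duality. In the infeasible case of [farkas] the separating functional consists of [t] on
    the vertices and [c] on the last coordinate. If [c] is positive, [t / c] is a fractional cover
    of value below [M]; if [c] is zero, a sum of nonnegative terms is negative. *)
Lemma packing_of_covers u M :
  cover_value u M -> exists2 w, fractional_packing u w & M <= \sum_F w F.
Proof.
move=> coverM.
(* The homogenised system: edges, coordinate vectors, and slack for [M]. *)
pose I : finType := ({set 'I_n} + ('I_n + unit))%type.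
pose V : finType := ('I_n + unit)%type.
pose g (i : I) (v : V) : rat := match i, v with
  | inl F, inl v => (v \in F)%:R
  | inl F, inr _ => -1
  | inr (inl v'), inl v => (v == v')%:R
  | inr (inr _), inr _ => 1
  | _, _ => 0 end.
pose b (v : V) : rat := if v is inl v then (u v)%:R else - M.
pose r := [seq i <- enum I | if i is inl F then F \in E else true].
have Vsum (f : V -> rat) : \sum_v f v = \sum_v f (inl v) + f (inr tt).
  by rewrite big_sumType /= (big_pred1 tt) //; case.
have ur : uniq r by rewrite filter_uniq ?enum_uniq.
have [[l [l0 lb]]|[y [yg yb]]] := farkas g b ur.
  have lsum v : b v = \sum_(F in E) l (inl F) * g (inl F) v +
      (\sum_v' l (inr (inl v')) * g (inr (inl v')) v + l (inr (inr tt)) * g (inr (inr tt)) v).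
    rewrite lb /r big_filter big_enum_cond /= big_sumType /= big_sumType /=.
    by congr (_ + (_ + _)); rewrite (big_pred1 tt) //; case.
  exists (fun F => if F \in E then l (inl F) else 0); first split=> [F|F|v].
  - by case: ifP.
  - by move/negPf->.
  - have := lsum (inl v); rewrite /= => ->.
    rewrite mulr0 addr0 ler_wpDr ?sumr_ge0 // => [i _|].
      by rewrite mulr_ge0 // ler0n.
    rewrite -big_mkcondr /= big_mkcond [leRHS]big_mkcond /=.
    by apply: ler_sum => F _; case: (F \in E); case: (v \in F); rewrite ?mulr1 ?mulr0.
  have := lsum (inr tt); rewrite /= mulr1 [X in _ = _ + (X + _)]big1 ?add0r; last first.
    by move=> i _; rewrite mulr0.
  rewrite -big_mkcond /= (eq_bigr (fun F => - l (inl F))); last first.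
    by move=> F _; rewrite mulrN1.
  by rewrite sumrN; have := l0 (inr (inr tt)); lra.
exfalso.
set t := fun v => y (inl v); set c := y (inr tt).
have yE F : F \in E -> c <= \sum_(v in F) t v.
  move=> FE; have := yg (inl F); rewrite mem_filter FE mem_enum => /(_ isT).
  rewrite Vsum /= mulN1r subr_ge0 -/c => /le_trans; apply.
  rewrite [leRHS]big_mkcond /=; apply: ler_sum => v _.
  by case: (v \in F); rewrite ?mul1r ?mul0r.
have t0 v : 0 <= t v.
  have := yg (inr (inl v)); rewrite mem_filter mem_enum => /(_ isT).
  rewrite Vsum /= mul0r addr0 (bigD1 v) //= eqxx mul1r big1 ?addr0 //.
  by move=> j /negPf->; rewrite mul0r.
have c0 : 0 <= c.
  have := yg (inr (inr tt)); rewrite mem_filter mem_enum => /(_ isT).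
  by rewrite Vsum /= mul1r big1 ?add0r // => j _; rewrite mul0r.
have : \sum_v t v * (u v)%:R < M * c.
  move: yb; rewrite Vsum /= mulNr subr_lt0.
  by under eq_bigr do rewrite mulrC.
have [c00|cneq] := eqVneq c 0.
  by rewrite c00 mulr0 ltNge sumr_ge0 // => v _; rewrite mulr_ge0 ?ler0n.
have cgt0 : 0 < c by rewrite lt_def cneq.
have : M <= \sum_v (t v / c) * (u v)%:R.
  apply: coverM; split=> [v|F FE]; first by rewrite divr_ge0.
  by rewrite -mulr_suml ler_pdivlMr // mul1r yE.
rewrite (eq_bigr (fun v => t v * (u v)%:R / c)); last by move=> v _; ring.
by rewrite -mulr_suml ler_pdivlMr // => /le_lt_trans h /h; rewrite ltxx.
Qed.

End FractionalCovers.

(** * Integral packings in r-partite hypergraphs *)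

Definition coloring n r (E : {set {set 'I_n}}) (c : 'I_n -> 'I_r) : Prop :=
  forall F, F \in E -> {in F &, injective c}.

Lemma partite_coloring n r (E : {set {set 'I_n}}) :
  partite r E -> exists c : 'I_n -> 'I_r, coloring E c.
Proof.
case=> V [_ cV VF]; pose c v := xchoose (cV v).
exists c => F FE v w vF wF cvw.
have := VF F (c v) FE; rewrite leqNgt => /negP nlt; apply: contrapT => /eqP vw.
apply: nlt; apply/card_gt1P; exists v, w; split=> //; rewrite inE ?vF ?wF /=.
  exact: (xchooseP (cV v)).
by rewrite cvw; apply: (xchooseP (cV w)).
Qed.

Lemma coloring_card n r (E : {set {set 'I_n}}) (c : 'I_n -> 'I_r) F :
  coloring E c -> F \in E -> (#|F| <= r)%N.
Proof.
by move=> cE FE; rewrite -(card_in_imset (cE F FE)) -[leqRHS]card_ord max_card.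
Qed.

(** By cardinality [c] maps [F] bijectively onto the colours. *)
Lemma colorful_sum n r (c : 'I_n -> 'I_r) (F : {set 'I_n}) i :
  {in F &, injective c} -> #|F| = r -> \sum_(v in F) (c v == i)%:R = 1 :> rat.
Proof.
move=> cF Fr.
have : i \in c @: F.
  suff -> : c @: F = [set: 'I_r] by rewrite inE.
  by apply/eqP; rewrite eqEcard finset.subsetT cardsT card_ord card_in_imset // Fr /=.
case/imsetP => v vF ->; rewrite (bigD1 v) //= eqxx big1 ?addr0 // => w /andP[wF wv].
by apply/eqP; rewrite pnatr_eq0 eqb0; apply: contra_neq wv; apply: cF.
Qed.

(* At a basic solution the incidence vectors of the edges of positive weight
   are independent over the saturated vertices. If all weights were below
   [1 / (r - 1)], every saturated vertex would lie on at least [r] such edges,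
   and double counting would force a nonsingular incidence matrix all of whose
   rows have exactly one entry in each colour class: this is singular. *)
Lemma heavy_edge n r (E : {set {set 'I_n}}) (c : 'I_n -> 'I_r) u w :
  (2 <= r)%N -> hypergraph E -> coloring E c -> (forall v, 0 < u v)%N ->
  fractional_packing E u w -> 0 < \sum_F w F ->
  exists w', [/\ fractional_packing E u w', forall F, w F = 0 -> w' F = 0,
    \sum_F w F <= \sum_F w' F
    & exists F, 0 < w' F /\ 1 <= (r%:R - 1) * w' F].
Proof.
move=> r2 hE cE u0 [w0 wE wu] wpos.
(* Slack variables at the vertices turn the packing inequalities into equations; only edges
   contribute to the cost. *)
pose J : finType := ({set 'I_n} + 'I_n)%type.
pose g (j : J) (v : 'I_n) : rat :=
  match j with inl F => (v \in F)%:R | inr v' => (v == v')%:R end.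
pose cost (j : J) : rat := if j is inl _ then 1 else 0.
pose p (j : J) : rat := match j with
  | inl F => w F
  | inr v => (u v)%:R - \sum_(F : {set 'I_n} | v \in F) w F end.
have Jsum (f : J -> rat) v : \sum_j f j * g j v =
    \sum_(F : {set 'I_n} | v \in F) f (inl F) + f (inr v).
  rewrite big_sumType /=; congr (_ + _).
    rewrite [RHS]big_mkcond; apply: eq_bigr => F _.
    by case: (v \in F); rewrite ?mulr1 ?mulr0.
  rewrite (bigD1 v) //= eqxx mulr1 big1 ?addr0 // => v' /negPf v'v.
  by rewrite eq_sym v'v mulr0.
have csum (f : J -> rat) : \sum_j cost j * f j = \sum_F f (inl F).
  rewrite big_sumType /= [X in _ + X]big1 ?addr0; last by move=> i _; rewrite mul0r.
  by apply: eq_bigr => F _; rewrite mul1r.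
have [||| p' [p'0 pp' p'g p'c ind]] := @basic_solution _ J 'I_n g cost p.
- by case=> a v; rewrite /= ler0n.
- case=> [F|v] pj; last by exists v; rewrite /= eqxx.
  have FE : F \in E by apply: contraNT pj => /wE wF; apply/eqP.
  have /eqP/set0Pn[v vF] := hE F FE.
  by exists v; rewrite /= vF.
- by case=> [F|v] //=; rewrite subr_ge0.
pose w' F := p' (inl F).
have w's v : \sum_(F : {set 'I_n} | v \in F) w' F + p' (inr v) = (u v)%:R.
  by have := p'g v; rewrite !Jsum /= => ->; rewrite addrC subrK.
move: p'c; rewrite !csum /= => w'w.
exists w'; split=> //.
- split=> [F|F /wE wF|v]; [exact: p'0|exact: (pp' (inl F))|].
  by rewrite -w's ler_wpDr.
- by move=> F wF; apply: (pp' (inl F)).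
apply: contrapT => /forallNP light.
have {}light F : w' F != 0 -> (r%:R - 1) * w' F < 1.
  move=> w'F; rewrite ltNge; apply/negP => h; apply: (light F); split=> //.
  by rewrite lt_def w'F p'0.
pose SE := [set F | w' F != 0]; pose T := [set v | p' (inr v) == 0].
pose S := [set j | p' j != 0].
have [|Scard Sfull] := @independent_card _ J 'I_n g S.
  move=> z zS; apply: ind => j pj; apply: zS.
  by rewrite inE pj eqxx.
rewrite card_ord in Scard Sfull.
(* The support [S] consists of the edges in [SE] and the slacks of the unsaturated vertices, so
   [#|S| <= n] amounts to [#|SE| <= #|T|]. *)
have ST : (#|S| + #|T| = #|SE| + n)%N.
  have -> : #|S| = (#|SE| + #|~: T|)%N.
    rewrite -!sum1_card big_mkcond /= big_sumType /= -!big_mkcond /=.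
    by congr (_ + _)%N; apply: eq_bigl => i; rewrite !inE.
  by rewrite -addnA [(#|~: T| + _)%N]addnC cardsC card_ord.
have SET : (#|SE| <= #|T|)%N by lia.
have rT v : v \in T -> (r <= \sum_(F in SE) (v \in F))%N.
  rewrite inE => /eqP pv.
  have := w's v; rewrite pv addr0 => wv.
  have [F0 vF0 w'F0] : exists2 F : {set 'I_n}, v \in F & w' F != 0.
    apply: contrapT => /forall2NP no.
    have := u0 v; rewrite -(ltr0n rat) -wv big1 ?ltxx // => F vF.
    by case: (no F) => // /negP; rewrite negbK => /eqP.
  (* The edges at [v] have total weight [u v], each of them lighter than [1 / (r - 1)]. Integrality
     and [u v >= 1] then give at least [r] edges. *)
  have : (r%:R - 1) * (u v)%:R < (\sum_(F in SE) (v \in F))%:R :> rat.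
    rewrite -wv mulr_sumr natr_sum [ltRHS]big_mkcond [ltLHS]big_mkcond /=.
    rewrite (bigD1 F0) //= [ltRHS](bigD1 F0) //= vF0 inE w'F0 ltr_leD ?light //.
    apply: ler_sum => F _; rewrite inE; case: (v \in F) => //=; last first.
      by case: ifP.
    case: ifPn => [/light/ltW //|]; rewrite negbK => /eqP ->.
    by rewrite mulr0.
  have r1 : (1 <= r)%N by lia.
  rewrite -(natrB _ r1) -natrM ltr_nat => h.
  apply: leq_trans h.
  by rewrite -[leqLHS](subnKC r1) add1n ltnS leq_pmulr.
have dc : (\sum_(v in T) \sum_(F in SE) (v \in F) = \sum_(F in SE) #|F :&: T|)%N.
  rewrite exchange_big /=; apply: eq_bigr => F _.
  rewrite -sum1_card big_mkcond [RHS]big_mkcond /=; apply: eq_bigr => v _.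
  by rewrite !inE andbC; case: (v \in F); case: (_ == _).
have SEE F : F \in SE -> F \in E.
  by rewrite inE; apply: contraNT => /wE/(pp' (inl F))/eqP.
have FTr F : F \in SE -> (#|F :&: T| <= r)%N.
  move=> /SEE FE; apply: leq_trans (coloring_card cE FE).
  exact/subset_leq_card/subsetIl.
have lower : (#|T| * r <= \sum_(F in SE) #|F :&: T|)%N.
  by rewrite -dc -sum_nat_const; apply: leq_sum.
have upper : (\sum_(F in SE) #|F :&: T| <= #|SE| * r)%N.
  by rewrite -sum_nat_const; apply: leq_sum.
have eqST : #|SE| = #|T| by nia.
have sumeq : (\sum_(F in SE) #|F :&: T| == \sum_(F in SE) r)%N.
  by rewrite eqn_leq sum_nat_const upper /= eqST.
have FTeq F : F \in SE -> #|F :&: T| = r.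
  have /leqif_sum[_] : forall F, F \in SE -> (#|F :&: T| <= r ?= iff (#|F :&: T| == r))%N.
    by move=> G GS; split=> //; apply: FTr.
  by rewrite sumeq => /esym/'forall_implyP h FS; apply/eqP/h.
have cFT F : F \in SE -> {in F :&: T &, injective c}.
  move=> /SEE/cE cF v v'; rewrite !inE => /andP[vF _] /andP[v'F _].
  exact: cF.
have r0 : (0 < r)%N by lia.
pose i0 := Ordinal r0; pose i1 := Ordinal r2.
(* Every edge in [SE] meets [T] once in each colour, so the difference of two colour classes of [T]
   is orthogonal to it. The slacks in [S] sit outside [T], where [y] vanishes. *)
pose y v : rat := if v \in T then (c v == i0)%:R - (c v == i1)%:R else 0.
have y0 : forall v, y v = 0.
  apply: Sfull; first by lia.
  case=> [F|v] jS /=; last first.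
    rewrite (bigD1 v) //= eqxx mul1r big1 ?addr0.
      by rewrite /y inE; move: jS; rewrite inE => /negPf ->.
    by move=> v' /negPf ->; rewrite mul0r.
  have FS : F \in SE by move: jS; rewrite !inE.
  have -> : \sum_v (v \in F)%:R * y v =
      \sum_(v in F :&: T) ((c v == i0)%:R - (c v == i1)%:R).
    rewrite [RHS]big_mkcond; apply: eq_bigr => v _.
    rewrite /y !inE; case: (v \in F); rewrite ?mul0r //= mul1r.
    by case: ifP.
  by rewrite sumrB !colorful_sum ?subrr //; [exact: cFT|exact: FTeq|exact: cFT|exact: FTeq].
have [F FS] : exists F, F \in SE.
  apply: contrapT => /forallNP noF.
  have := lt_le_trans wpos w'w; rewrite big1 ?ltxx // => F _.
  by have /negP := noF F; rewrite inE negbK => /eqP.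
(* Since [y] is zero, no vertex of [T] has colour [i0], although [F] has such a vertex in [T]. *)
have := colorful_sum i0 (cFT F FS) (FTeq F FS); rewrite big1.
  by move=> /esym/eqP; rewrite oner_eq0.
move=> v; rewrite inE => /andP[_ vT].
have := y0 v; rewrite /y vT; case: eqP => // -> /eqP.
by rewrite (_ : (i0 == i1) = false) //= subr0 oner_eq0.
Qed.

(** The edge removed is a heavy edge of an optimised packing. Pairing the packing with a cover
    truncated at 1 bounds the loss, since the truncated cover gives the heavy edge at most [r]. *)
Lemma furedi_step n r (E : {set {set 'I_n}}) (c : 'I_n -> 'I_r) u (M : rat) :
  (2 <= r)%N -> hypergraph E -> coloring E c -> 0 < M -> cover_value E u M ->
  exists F, [/\ F \in E, forall v, v \in F -> (0 < u v)%N
    & cover_value E (fun v => u v - (v \in F))%N (M - (r%:R - 1))].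
Proof.
move=> r2 hE cE M0 /packing_of_covers[w [w0 wE wu] wM].
(* [heavy_edge] needs positive capacities. Raising the zero ones is harmless: edges through such
   vertices have weight 0 in [w], hence also in [w']. *)
pose u1 v := maxn (u v) 1.
have wu1 : fractional_packing E u1 w.
  by split=> // v; apply: le_trans (wu v) _; rewrite ler_nat leq_maxl.
have u10 v : (0 < u1 v)%N by rewrite leq_max orbT.
have [w' [[w'0 w'E w'u1] ww' w'w [F [wF Fr]]]] :=
  heavy_edge r2 hE cE u10 wu1 (lt_le_trans M0 wM).
have {w'u1} w'u v : \sum_(F : {set 'I_n} | v \in F) w' F <= (u v)%:R.
  have [uv|] := posnP (u v); last first.
    by move=> uv; have := w'u1 v; rewrite /u1 (maxn_idPl uv).
  rewrite big1 // => G vG; apply: ww'; apply/eqP; rewrite eq_le w0 andbT.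
  have := wu v; rewrite uv; apply: le_trans; rewrite (bigD1 G) //= ler_wpDr //.
  by apply: sumr_ge0.
have FE : F \in E by apply: contraTT wF => /w'E ->; rewrite ltxx.
have uF v : v \in F -> (0 < u v)%N.
  move=> vF; rewrite -(ltr0n rat) (lt_le_trans wF) //.
  by apply: le_trans (w'u v); rewrite (bigD1 F) //= ler_wpDr // sumr_ge0.
exists F; split=> // t [t0 tE].
pose t1 v : rat := Order.min (t v) 1.
have t10 v : 0 <= t1 v by rewrite le_min t0 ler01.
pose T (G : {set 'I_n}) : rat := \sum_(v in G) t1 v.
have TE G : G \in E -> 1 <= T G.
  move=> GE; have [[v [vG tv]]|/forallNP small] := pselect (exists v, v \in G /\ 1 <= t v).
    rewrite /T (bigD1 v) //= /t1 (min_idPr tv) ler_wpDr //.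
    by apply: sumr_ge0 => *; apply: t10.
  rewrite /T (eq_bigr t) ?tE // => v vG; apply/min_idPl.
  by rewrite leNgt; apply/negP => /ltW tv; apply: (small v).
have Tr : T F <= r%:R.
  apply: (@le_trans _ _ #|F|%:R); last by rewrite ler_nat (coloring_card cE).
  by rewrite -sum1_card natr_sum; apply: ler_sum => v _; rewrite ge_min lexx orbT.
have tu : \sum_v t1 v * (u v)%:R - T F <= \sum_v t v * (u v - (v \in F))%:R.
  rewrite /T [X in _ - X]big_mkcond -sumrB; apply: ler_sum => v _.
  apply: (@le_trans _ _ (t1 v * (u v - (v \in F))%:R)); last first.
    by rewrite ler_wpM2r ?ler0n // ge_min lexx.
  case: ifPn => vF; last by rewrite subr0 subn0.
  by rewrite natrB ?uF // mulrBr mulr1.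
apply: le_trans tu.
have : \sum_G w' G * T G <= \sum_v t1 v * (u v)%:R.
  rewrite (eq_bigr (fun G : {set 'I_n} => \sum_v (if v \in G then w' G * t1 v else 0))); last first.
    by move=> G _; rewrite mulr_sumr big_mkcond.
  rewrite exchange_big /=; apply: ler_sum => v _.
  rewrite -big_mkcond -mulr_suml mulrC ler_wpM2l //; exact: w'u.
rewrite (bigD1 F) //=.
have : \sum_F w' F - w' F <= \sum_(G | G != F) w' G * T G.
  rewrite (bigD1 F) //= addrAC subrr add0r; apply: ler_sum => G _.
  have [/TE GE|/w'E ->] := boolP (G \in E); last by rewrite mul0r.
  by rewrite ler_peMr.
have r2' : 2 <= r%:R :> rat by rewrite ler_nat.
have := TE F FE; move: (w'w) Fr Tr wM.
set W := \sum_F w' F; set W0 := \sum_F w F; set X := \sum_(G | _) _.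
move: (\sum_v _) (T F) (w' F) (r%:R : rat) r2' => Y tF x q *.
(* With [x] the weight of the heavy edge and [tF] its cover value, the term to bound below is
   [(x - 1) * tF]. Its minimum is at [tF = q] when [x <= 1], where [(q - 1) * x >= 1] concludes, and
   at [tF = 1] otherwise. *)
have [x1|x1] := leP x 1; nra.
Qed.

(** Each removal costs at most [r - 1], so after [k] removals the bound is still 1, which pays for
    one more edge. *)
Lemma integral_packing n r (E : {set {set 'I_n}}) (c : 'I_n -> 'I_r) k u :
  (2 <= r)%N -> hypergraph E -> coloring E c ->
  cover_value E u ((r%:R - 1) * k%:R + 1) ->
  exists s : seq {set 'I_n}, [/\ size s = k.+1, {subset s <= E}
    & forall v, (count (fun F : {set 'I_n} => v \in F) s <= u v)%N].
Proof.
move=> r2 hE cE.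
have r1 : 0 <= r%:R - 1 :> rat by rewrite subr_ge0 ler1n; lia.
elim: k u => [|k IH] u hu.
  have [|F [FE Fu _]] := furedi_step r2 hE cE _ hu.
    by rewrite mulr0 add0r.
  exists [:: F]; split=> // [G|v]; first by rewrite inE => /eqP ->.
  by rewrite /= addn0; case: (boolP (v \in F)) => // /Fu.
have [|F [FE Fu hu']] := furedi_step r2 hE cE _ hu.
  by rewrite ltr_wpDl // mulr_ge0 // ler0n.
have [|s [ss sE sv]] := IH (fun v => u v - (v \in F))%N.
  by congr cover_value : hu'; rewrite -natr1; ring.
exists (F :: s); split=> [|G|v] /=; first by rewrite ss.
  by rewrite inE => /predU1P[->|/sE].
have := sv v; case: (boolP (v \in F)) => [/Fu|_]; rewrite /=; lia.
Qed.

(** * Integral covers of r-partite hypergraphs *)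

Definition levels n (A : {set 'I_n}) (t : 'I_n -> rat) (u : 'I_n -> nat) : seq rat :=
  sort >=%R (flatten [seq nseq (u v) (t v) | v <- enum A]).

Lemma levels_ge0 n (A : {set 'I_n}) t u j :
  (forall v, 0 <= t v) -> 0 <= nth 0 (levels A t u) j.
Proof.
move=> t0; have [jL|jL] := ltnP j (size (levels A t u)); last by rewrite nth_default.
have := mem_nth 0 jL; rewrite {2}/levels mem_sort => /flattenP[s /mapP[v _ ->]].
by rewrite mem_nseq => /andP[_ /eqP ->].
Qed.

(** In decreasing order, only the first [j] entries can exceed the entry at index [j]. For [j] past
    the end, the length of the list is already at most [j]. *)
Lemma levels_count n (A : {set 'I_n}) t u j :
  (\sum_(v in A | (nth 0 (levels A t u) j < t v)%R) u v <= j)%N.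
Proof.
set L := levels A t u; set x := nth 0 L j.
have -> : (\sum_(v in A | (x < t v)%R) u v = count (fun y => x < y)%R L)%N.
  rewrite count_sort count_flatten sumnE !big_map.
  rewrite big_enum /= big_mkcondr /=; apply: eq_bigr => v _.
  by rewrite count_nseq; case: (x < t v)%R; rewrite ?mul1n.
have [jL|jL] := leqP (size L) j; first exact: leq_trans (count_size _ _) jL.
rewrite -(cat_take_drop j L) count_cat [X in (_ + X)%N](_ : _ = 0%N); last first.
  apply/eqP; rewrite -leqn0 leqNgt -has_count; apply/hasPn => y /(nthP 0)[i].
  rewrite size_drop => ij <-; rewrite nth_drop -leNgt.
  have ge_trans : transitive (>=%R : rel rat) by move=> a b d ba; move/le_trans; apply.
  have ge_refl : reflexive (>=%R : rel rat) by move=> a; apply: lexx.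
  have Ls : sorted >=%R L by apply: sort_sorted => a b; apply: le_total.
  by apply: (sorted_leq_nth ge_trans ge_refl 0 Ls); rewrite ?inE ?leq_addr -?ltn_subRL.
by rewrite addn0 (leq_trans (count_size _ _)) // size_takel // ltnW.
Qed.

Lemma sum_nth_le (L : seq rat) k :
  (forall x, x \in L -> 0 <= x) -> \sum_(j < k) nth 0 L j <= \sum_(x <- L) x.
Proof.
elim: L k => [|x L IH] [|k] L0; rewrite ?big_nil ?big_ord0 //.
- by rewrite big1 // => i _; rewrite nth_nil.
- by rewrite big_seq sumr_ge0.
rewrite big_ord_recl big_cons lerD2l /=; apply: IH => y yL.
by apply: L0; rewrite inE yL orbT.
Qed.

Lemma levels_sum n (A : {set 'I_n}) t u k :
  (forall v, 0 <= t v) ->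
  \sum_(j < k) nth 0 (levels A t u) j <= \sum_(v in A) t v * (u v)%:R.
Proof.
move=> t0.
have -> : \sum_(v in A) t v * (u v)%:R = \sum_(x <- levels A t u) x.
  rewrite (perm_big _ (permEl (perm_sort _ _))) big_flatten big_map /= big_enum /=.
  by apply: eq_bigr => v _; rewrite big_nseq -Monoid.iteropE /= mulr_natr.
apply: sum_nth_le => x; rewrite mem_sort => /flattenP[s /mapP[v _ ->]].
by rewrite mem_nseq => /andP[_ /eqP ->].
Qed.

(* Permutations of [{0, .., k-1}] with balanced sums: complementary pairs
   [s], [k-1-s], plus, for odd [r], three permutations with all sums at most
   [uphalf (3 * (k - 1))]. *)
Definition balanced_pair (k i s : nat) : nat := if odd i then (k.-1 - s)%N else s.

Definition balanced (k r i s : nat) : nat :=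
  (if odd r then
    match i with
    | 0 => s
    | 1 => if odd s then k.-1 - s./2 else k.-1./2 - s./2
    | 2 => if odd s then k./2.-1 - s./2 else k.-1 - s./2
    | i.+3 => balanced_pair k i s
    end
  else balanced_pair k i s)%N.

Lemma balanced_lt k r i s : (s < k)%N -> (balanced k r i s < k)%N.
Proof.
rewrite /balanced /balanced_pair.
case: (odd r) => [|sk]; last by case: ifP => _; lia.
by case: i => [|[|[|i]]] // sk; case: ifP => _; lia.
Qed.

Lemma balanced_inj k r i s s' : (s < k)%N -> (s' < k)%N ->
  balanced k r i s = balanced k r i s' -> s = s'.
Proof.
rewrite /balanced /balanced_pair => sk s'k.
case: (odd r); last by case: ifP => _; lia.
case: i => [|[|[|i]]] //; last by case: ifP => _; lia.
- by case: ifP => ?; case: ifP => ?; lia.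
- by case: ifP => ?; case: ifP => ?; lia.
Qed.

Lemma balanced_sum k r s : (2 <= r)%N -> (s < k)%N ->
  (\sum_(i < r) balanced k r i s <= uphalf (r * (k - 1)))%N.
Proof.
move=> r2 sk.
have pairs m : (\sum_(i < m.*2) balanced_pair k i s = m * (k - 1))%N.
  elim: m => [|m IH]; first by rewrite big_ord0.
  rewrite doubleS !big_ord_recr /= IH /balanced_pair /= odd_double /=; lia.
have [m] : exists m, r = m.*2 \/ r = m.*2.+3.
  by case: (boolP (odd r)) => ro; [exists (r - 3)./2; right|exists r./2; left]; lia.
case=> rm; subst r.
  rewrite /balanced odd_double pairs -muln2; lia.
rewrite /balanced /= odd_double /= !big_ord_recl /= pairs.
have -> : (uphalf (m.*2.+3 * (k - 1)) = m * (k - 1) + uphalf (3 * (k - 1)))%N by lia.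
(* The first three terms sum to [k - 1 + (k - 1)./2] for even [s] and to [k - 1 + k./2] for odd [s];
   the latter is [uphalf (3 * (k - 1))]. *)
by case: ifP => so; lia.
Qed.

(* For each sample [s], discarding the [balanced k r i s] largest values of [t]
   in every colour class [i] leaves some edge uncovered, so the next values
   sum to at least [1]; averaging over [s] bounds [t] from below. *)
Lemma lovasz_cover n r (E : {set {set 'I_n}}) (c : 'I_n -> 'I_r) k u :
  (2 <= r)%N -> coloring E c ->
  (forall C : {set 'I_n}, (forall F, F \in E -> F :&: C != finset.set0) ->
     (uphalf (r * (k - 1)) < \sum_(v in C) u v)%N) ->
  cover_value E u k%:R.
Proof.
move=> r2 cE uC t [t0 tE].
pose T i j := nth 0 (levels [set v | c v == i] t u) j.
have T0 i j : 0 <= T i j by apply: levels_ge0.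
have sample (s : 'I_k) : 1 <= \sum_i T i (balanced k r i s).
  pose C := [set v | T (c v) (balanced k r (c v) s) < t v].
  have Cu : (\sum_(v in C) u v <= uphalf (r * (k - 1)))%N.
    apply: leq_trans (balanced_sum r2 (ltn_ord s)).
    rewrite (partition_big c xpredT) //=; apply: leq_sum => i _.
    apply: leq_trans (levels_count [set v | c v == i] t u _).
    rewrite leq_eqVlt; apply/orP; left; apply/eqP; apply: eq_bigl => v.
    by rewrite !inE andbC; case: eqP => // ->.
  have [F FE FC] : exists2 F, F \in E & F :&: C = finset.set0.
    apply: contrapT => /forall2NP no; move: Cu; apply/negP; rewrite -ltnNge.
    by apply: uC => F FE; apply/eqP => FC; case: (no F).
  apply: le_trans (tE F FE) _.
  apply: (@le_trans _ _ (\sum_(v in F) T (c v) (balanced k r (c v) s))).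
    apply: ler_sum => v vF; rewrite leNgt; apply/negP => tv.
    have : v \in F :&: C by rewrite !inE vF.
    by rewrite FC inE.
  (* The vertices of an edge have distinct colours, so each threshold is used at most once. *)
  rewrite -(big_imset (fun i => T i (balanced k r i s)) (cE F FE)) /=.
  by rewrite [leRHS](bigID (mem (c @: F))) /= ler_wpDr // sumr_ge0.
have -> : k%:R = \sum_(s < k) 1 :> rat by rewrite sumr_const card_ord.
apply: le_trans (ler_sum _ (fun s _ => sample s)) _.
rewrite exchange_big /= [leRHS](partition_big c xpredT) //=.
apply: ler_sum => i _.
(* For a fixed colour the samples visit each index below [k] exactly once, so their thresholds add
   up to the [k] largest levels of that class. *)
pose h (s : 'I_k) := Ordinal (balanced_lt r i (ltn_ord s)).
have h_inj : injective h.
  move=> s s' /(congr1 val) /= ss'; apply: val_inj.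
  exact: balanced_inj ss'.
apply: le_trans (le_trans _ (levels_sum [set v | c v == i] u k t0)) _; last first.
  rewrite le_eqVlt; apply/orP; left; apply/eqP.
  by apply: eq_bigl => v; rewrite inE.
by rewrite [leRHS](reindex_inj h_inj).
Qed.

(** * Integral closure of ideals *)

Local Open Scope classical_set_scope.

Section IdealPowers.

Variable R : comNzRingType.
Implicit Types (J S : set R) (x y : R).

Lemma ideal_gen_ideal S : is_ideal (ideal_gen S).
Proof.
split=> [A [[A0 _ _] _]|x y Sx Sy A AS|a x Sx A AS] //.
  by case: (AS) => -[_ AD _] _; apply: AD; [apply: Sx|apply: Sy].
by case: (AS) => -[_ _ AM] _; apply: AM; apply: Sx.
Qed.

Lemma sub_ideal_gen S : S `<=` ideal_gen S.
Proof. exact: sub_smallest. Qed.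

Lemma ideal_gen_min S J : is_ideal J -> S `<=` J -> ideal_gen S `<=` J.
Proof. by move=> iJ SJ; apply: smallest_sub. Qed.

Lemma ideal_sum J (I : Type) (r : seq I) (P : pred I) (F : I -> R) :
  is_ideal J -> (forall i, P i -> J (F i)) -> J (\sum_(i <- r | P i) F i).
Proof. by case=> J0 JD _ JF; apply: big_ind. Qed.

Lemma idealMr J x y : is_ideal J -> J x -> J (x * y).
Proof. by case=> _ _ JM Jx; rewrite mulrC; apply: JM. Qed.

Lemma ideal_pow_ideal J h : is_ideal (ideal_pow J h).
Proof. exact: ideal_gen_ideal. Qed.

Lemma ideal_pow_prod J (s : seq R) :
  (forall x, x \in s -> J x) -> ideal_pow J (size s) (\prod_(x <- s) x).
Proof.
move=> Js; apply: sub_ideal_gen; exists (fun i => nth 0 s i); split=> [i|].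
  by apply: Js; apply: mem_nth.
by rewrite (big_nth 0) big_mkord.
Qed.

Lemma ideal_pow0 J x : ideal_pow J 0 x.
Proof.
rewrite -[x]mul1r; apply: (idealMr _ (ideal_pow_ideal _ _)).
by have := @ideal_pow_prod J [::]; rewrite big_nil; apply.
Qed.

Lemma ideal_pow1 J : J `<=` ideal_pow J 1.
Proof.
move=> x Jx; have := @ideal_pow_prod J [:: x]; rewrite big_seq1; apply => y.
by rewrite inE => /eqP ->.
Qed.

(** The elements multiplying a given set into the power [a + b] form an ideal, so first [x] and then
    [y] may be taken to be a product of elements of [J]. *)
Lemma ideal_powM J a b x y :
  ideal_pow J a x -> ideal_pow J b y -> ideal_pow J (a + b) (x * y).
Proof.
have [J0 JD JM] := ideal_pow_ideal J (a + b).
have colon (S : set R) : is_ideal [set z | forall w, S w -> ideal_pow J (a + b) (z * w)].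
  split=> [w _|z z' hz hz' w Sw|c z hz w Sw]; first by rewrite mul0r.
    by rewrite mulrDl; apply: JD; [exact: hz _ Sw|exact: hz' _ Sw].
  by rewrite -mulrA; apply: JM; exact: hz _ Sw.
move=> ax; move: y; change ([set z | forall w, ideal_pow J b w ->
  ideal_pow J (a + b) (z * w)] x); apply: (ideal_gen_min (colon _)) ax.
move=> _ [f [Jf ->]] y byy; rewrite mulrC.
suff: [set z | forall w, w = \prod_i f i -> ideal_pow J (a + b) (z * w)] y by apply.
apply: (ideal_gen_min (colon _)) byy => _ [g [Jg ->]] _ ->; rewrite mulrC.
apply: sub_ideal_gen.
exists (fun i => match split i with inl i => f i | inr i => g i end); split=> [i|].
  by case: split.
rewrite big_split_ord /=; congr (_ * _); apply: eq_bigr => i _.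
  by rewrite -[lshift b i]/(unsplit (inl i)) unsplitK.
by rewrite -[rshift a i]/(unsplit (inr i)) unsplitK.
Qed.

Lemma ideal_pow_pow J a b (s : seq R) :
  (forall x, x \in s -> J x) -> size s = (a * b)%N ->
  ideal_pow (ideal_pow J a) b (\prod_(x <- s) x).
Proof.
elim: b s => [|b IH] s Js ss; first exact: ideal_pow0.
rewrite -(cat_take_drop a s) big_cat -add1n; apply: ideal_powM.
  apply: ideal_pow1; have {1}-> : a = size (take a s) by rewrite size_takel //; lia.
  by apply: ideal_pow_prod => x /mem_take/Js.
apply: IH => [x /mem_drop/Js //|]; rewrite size_drop ss; lia.
Qed.

End IdealPowers.

(* [x] is integral over the ideal [J] iff [x *: 'X] is integral over the Rees
   algebra of [J], so that integral closures of ideals inherit their closure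
   properties from those of integral elements over a ring. *)
Section ReesAlgebra.

Variables (R : comNzRingType) (J : set R).

Definition rees_pred : {pred {poly R}} :=
  fun q => `[< forall j, ideal_pow J j q`_j >].

Lemma rees_predP (q : {poly R}) :
  reflect (forall j, ideal_pow J j q`_j) (q \in rees_pred).
Proof. exact: asboolP. Qed.

Lemma rees_subring_closed : subring_closed rees_pred.
Proof.
split=> [|p q|p q].
- apply/rees_predP => -[|j]; first exact: ideal_pow0.
  by rewrite coef1 /=; case: (ideal_pow_ideal J j.+1).
- move=> /rees_predP pJ /rees_predP qJ; apply/rees_predP => j.
  have [_ JD JM] := ideal_pow_ideal J j.
  by rewrite coefB -mulN1r; apply: JD => //; apply: JM.
- move=> /rees_predP pJ /rees_predP qJ; apply/rees_predP => j.
  rewrite coefM; apply: ideal_sum; first exact: ideal_pow_ideal.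
  move=> i _; have {1}<- : (i + (j - i) = j)%N by have := ltn_ord i; lia.
  exact: ideal_powM.
Qed.

HB.instance Definition _ :=
  GRing.isSubringClosed.Build {poly R} rees_pred rees_subring_closed.

Record rees := Rees { rees_val :> {poly R}; _ : rees_val \in rees_pred }.

HB.instance Definition _ := [isSub for rees_val].
HB.instance Definition _ := [Choice of rees by <:].
HB.instance Definition _ := [SubChoice_isSubComNzRing of rees by <:].

Lemma rees_valP (q : rees) j : ideal_pow J j (rees_val q)`_j.
Proof. by case: q => q /= /rees_predP. Qed.

(** Compare coefficients of ['X^d] in a monic relation of degree [d] for [x *: 'X]: the term of
    index [i] contributes [x ^+ i] times a coefficient in degree [d - i], which lies in that power
    of [J]. *)
Lemma integral_closure_rees x :
  integralOver (val : rees -> {poly R}) (x *: 'X) -> integral_closure J x.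
Proof.
case=> p p_monic /eqP px.
pose d := (size p).-1.
have p_d : p`_d = 1 by apply/eqP.
have sp : size p = d.+1.
  by rewrite /d prednK // lt0n size_poly_eq0 monic_neq0.
have psum : \sum_(i < d.+1) (val p`_i)`_(d - i) * x ^+ i = 0.
  have := congr1 (fun q : {poly R} => q`_d) px; rewrite coef0 => pxd.
  rewrite -[RHS]pxd horner_coef size_map_poly_id0; last first.
    by rewrite (monicP p_monic) rmorph1 oner_neq0.
  rewrite sp /= coef_sum; apply: eq_bigr => i _.
  rewrite coef_map_id0 ?rmorph0 // exprZn -scalerAr coefZ coefMXn mulrC ltnNge.
  by rewrite -ltnS ltn_ord.
exists d, (fun i => (val p`_(d - i))`_i); split.
- rewrite lt0n; apply/eqP => d0.
  have p_0 : p`_0 = 1 by rewrite -d0.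
  move: psum; rewrite d0 big_ord_recl big_ord0 /= p_0 coef1 mul1r addr0 => /eqP.
  by rewrite oner_eq0.
- by move=> i _; apply: rees_valP.
- rewrite -[RHS]psum big_ord_recr /= p_d subnn coef1 mul1r addrC.
  congr (_ + _); rewrite (big_addn 0 d.+1 1) subn1 big_mkord (reindex_inj rev_ord_inj).
  apply: eq_bigr => i _ /=; have lti := ltn_ord i.
  have -> : (d - i.+1 + 1 = d - i)%N by lia.
  by rewrite subKn // ltnW.
Qed.

(** The power [(x *: 'X) ^+ N] already lies in the Rees algebra. *)
Lemma integral_rees x N :
  (0 < N)%N -> ideal_pow J N (x ^+ N) ->
  integralOver (val : rees -> {poly R}) (x *: 'X).
Proof.
move=> N0 xN.
have xNT : (x ^+ N) *: 'X^N \in rees_pred.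
  apply/rees_predP => j; rewrite coefZ coefXn.
  case: eqP => [->|_]; first by rewrite mulr1.
  by rewrite mulr0; case: (ideal_pow_ideal J j).
exists ('X^N - (Rees xNT)%:P); first exact: monicXnsubC.
have -> : map_poly (val : rees -> {poly R}) ('X^N - (Rees xNT)%:P) =
    'X^N - (x ^+ N *: 'X^N)%:P.
  by rewrite rmorphB; congr (_ - _); [exact: map_polyXn|exact: map_polyC].
by rewrite /root !hornerE exprZn subrr.
Qed.

Lemma integral_closure_sum (I : Type) (r : seq I) (P : pred I) (c y : I -> R) :
  (forall i, P i -> exists2 N, (0 < N)%N & ideal_pow J N (y i ^+ N)) ->
  integral_closure J (\sum_(i <- r | P i) c i * y i).
Proof.
move=> yJ; apply: integral_closure_rees; rewrite scaler_suml.
apply: (big_ind (integralOver (val : rees -> {poly R}))).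
- exact: integral0.
- exact: integral_add.
move=> i Pi; rewrite -scalerA -mul_polyC; apply: integral_mul.
  have cP : (c i)%:P \in rees_pred.
    apply/rees_predP => -[|j]; first exact: ideal_pow0.
    by rewrite coefC /=; case: (ideal_pow_ideal J j.+1).
  exact: (integral_id _ (Rees cP)).
by have [N N0 yN]  := yJ i Pi; apply: integral_rees yN.
Qed.

End ReesAlgebra.

(** * Weights of monomials and symbolic powers *)

Section Weights.

Variables (K : fieldType) (n : nat).
Implicit Types (p q : {mpoly K[n]}) (m : 'X_{1..n}) (t : 'I_n -> nat).

Definition msupp_in (Q : 'X_{1..n} -> Prop) : set {mpoly K[n]} :=
  [set p | forall m, m \in msupp p -> Q m].

Lemma msupp_in0 Q : msupp_in Q 0.
Proof. by move=> m; rewrite -mpolyC0 msupp0. Qed.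

Lemma msupp_inD Q p q : msupp_in Q p -> msupp_in Q q -> msupp_in Q (p + q).
Proof.
by move=> pQ qQ m /msuppD_le; rewrite mem_cat => /orP[/pQ|/qQ].
Qed.

Lemma msupp_inN Q p : msupp_in Q p -> msupp_in Q (- p).
Proof. by move=> pQ m; rewrite (perm_mem (msuppN p)) => /pQ. Qed.

Lemma msupp_inM (Q1 Q2 Q : 'X_{1..n} -> Prop) p q :
  (forall m1 m2, Q1 m1 -> Q2 m2 -> Q (m1 + m2)%MM) ->
  msupp_in Q1 p -> msupp_in Q2 q -> msupp_in Q (p * q).
Proof.
by move=> Q12 pQ qQ m /msuppM_le/allpairsP[[m1 m2] /= [/pQ ? /qQ ? ->]]; apply: Q12.
Qed.

Lemma msupp_in_terms Q p (P : pred 'X_{1..n}) :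
  (forall m, m \in msupp p -> P m -> Q m) ->
  msupp_in Q (\sum_(m <- msupp p | P m) p@_m *: 'X_[m]).
Proof.
move=> pQ; rewrite big_seq_cond; apply: big_ind => [||m /andP[mp Pm] m'].
- exact: msupp_in0.
- exact: msupp_inD.
by move=> /msuppZ_le/mem_msuppXP <-; apply: pQ.
Qed.

Definition weight t m : nat := \sum_i t i * m i.

Lemma weightD t m1 m2 : weight t (m1 + m2)%MM = (weight t m1 + weight t m2)%N.
Proof. by rewrite -big_split; apply: eq_bigr => i _; rewrite mnmDE mulnDr. Qed.

Lemma weight0 t : weight t 0%MM = 0%N.
Proof. by rewrite /weight big1 // => i _; rewrite mnm0E muln0. Qed.

(** The valuation ideals of the monomial valuation with weights [t]. *)
Definition weight_ideal t h : set {mpoly K[n]} :=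
  msupp_in (fun m => (h <= weight t m)%N).

Lemma weight_idealM t a b p q :
  weight_ideal t a p -> weight_ideal t b q -> weight_ideal t (a + b)%N (p * q).
Proof. by apply: msupp_inM => m1 m2 ? ?; rewrite weightD leq_add. Qed.

Lemma weight_ideal_ideal t h : is_ideal (weight_ideal t h).
Proof.
split=> [|p q|a p ph]; [exact: msupp_in0|exact: msupp_inD|].
by rewrite -[h]add0n; apply: weight_idealM => // m.
Qed.

Lemma weight_ideal_leq t a b : (a <= b)%N -> weight_ideal t b `<=` weight_ideal t a.
Proof. by move=> ab p pb m /pb; apply: leq_trans. Qed.

Lemma weight_ideal_expr t a p d :
  weight_ideal t a p -> weight_ideal t (a * d) (p ^+ d).
Proof.
move=> pa; elim: d => [|d IH]; first by rewrite muln0 => m.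
by rewrite mulnS exprS; apply: weight_idealM.
Qed.

Lemma weight_ideal_pow t a h (J : set {mpoly K[n]}) :
  J `<=` weight_ideal t a -> ideal_pow J h `<=` weight_ideal t (a * h).
Proof.
move=> Ja; apply: ideal_gen_min; first exact: weight_ideal_ideal.
move=> _ [f [Jf ->]]; elim: h f Jf => [|h IH] f Jf; first by rewrite muln0 => m.
rewrite big_ord_recl mulnS; apply: weight_idealM; first exact: Ja.
exact: IH.
Qed.

(* The product of the initial forms of [p] and [q] is nonzero unless one of
   them vanishes, so the weight order is a valuation. *)
Lemma weight_ideal_valuation t a b p q :
  weight_ideal t a p -> weight_ideal t b q -> weight_ideal t (a + b).+1 (p * q) ->
  weight_ideal t a.+1 p \/ weight_ideal t b.+1 q.
Proof.
pose form c := msupp_in (fun m => weight t m = c).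
have split_form c r : weight_ideal t c r ->
    exists g h, [/\ r = g + h, form c g & weight_ideal t c.+1 h].
  move=> rc.
  exists (\sum_(m <- msupp r | weight t m == c) r@_m *: 'X_[m]).
  exists (\sum_(m <- msupp r | weight t m != c) r@_m *: 'X_[m]).
  split; first by rewrite [LHS]mpolyE (bigID (fun m => weight t m == c)).
    by apply: msupp_in_terms => m _ /eqP.
  by apply: msupp_in_terms => m /rc; rewrite [(_ < _)%N]ltn_neqAle eq_sym => -> ->.
move=> /split_form[g [h [-> ga ha]]] /split_form[g' [h' [-> gb hb]]].
have gW c r : form c r -> weight_ideal t c r by move=> rc m /rc ->.
have [_ WD _] := weight_ideal_ideal t (a + b).+1.
move=> ghW; have : weight_ideal t (a + b).+1 (g * g').
  have -> : g * g' = (g + h) * (g' + h') - (g * h' + h * (g' + h')) by ring.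
  apply: (WD _ _ ghW); apply: msupp_inN; apply: WD.
    by rewrite -addnS; apply: weight_idealM => //; apply: gW.
  rewrite -addSn; apply: weight_idealM => //.
  have [_ WbD _] := weight_ideal_ideal t b; apply: WbD; first exact: gW.
  exact: (weight_ideal_leq (leqnSn b)).
move=> ggW; have gg : form (a + b)%N (g * g').
  by apply: (msupp_inM _ ga gb) => m1 m2 <- <-; rewrite weightD.
have /eqP : g * g' = 0.
  apply/mpolyP => m; rewrite mcoeff0; apply/eqP; rewrite mcoeff_eq0.
  by apply/negP => mg; have := ggW m mg; rewrite (gg m mg) ltnn.
rewrite mulf_eq0 => /orP[/eqP->|/eqP->]; [left|right]; rewrite add0r //.
Qed.

Lemma weight_ideal_root t a p d :
  weight_ideal t a p -> weight_ideal t (a * d).+1 (p ^+ d) -> weight_ideal t a.+1 p.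
Proof.
move=> pa; elim: d => [|d IH].
  rewrite muln0 expr0 => /(_ 0%MM); rewrite -mpolyC1 msupp1 inE eqxx weight0.
  by move/(_ isT).
rewrite exprS mulnS => /(weight_ideal_valuation pa (weight_ideal_expr (d := d) pa)).
by case=> // /IH.
Qed.

(** If [x] has order at least [b < a], every term [c i * x ^+ (d - i)] with [i > 0] has order at
    least [a * i + b * (d - i) > b * d]. So does [x ^+ d], and [x] has order at least [b + 1]. *)
Lemma integral_closure_weight t a (J : set {mpoly K[n]}) :
  J `<=` weight_ideal t a -> integral_closure J `<=` weight_ideal t a.
Proof.
move=> Ja x [d [c [d0 cJ xd]]].
suff: forall b, (b <= a)%N -> weight_ideal t b x by apply.
elim=> [|b IH] ba; first by move=> m.
have xb := IH (ltnW ba); apply: (weight_ideal_root (d := d) xb).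
move/eqP: xd; rewrite addr_eq0 => /eqP ->; apply: msupp_inN.
rewrite big_nat; apply: ideal_sum; first exact: weight_ideal_ideal.
move=> i /andP[i0 id].
apply: (@weight_ideal_leq _ _ (a * i + b * (d - i))); first by nia.
apply: weight_idealM; last exact: weight_ideal_expr.
by apply: (weight_ideal_pow Ja); apply: cJ; rewrite i0.
Qed.

(** The ideal generated by the variables of [C], in a form that makes it prime by the valuation
    property. *)
Definition vertex_prime (C : {set 'I_n}) : set {mpoly K[n]} :=
  weight_ideal (fun v => v \in C) 1.

Lemma weight_set (C : {set 'I_n}) m :
  weight (fun v => v \in C) m = (\sum_(v in C) m v)%N.
Proof.
rewrite /weight [RHS]big_mkcond; apply: eq_bigr => v _.
by case: (v \in C); rewrite ?mul1n.
Qed.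

Lemma vertex_prime_prime C : prime_ideal (vertex_prime C).
Proof.
split=> [||x y xy]; first exact: weight_ideal_ideal.
  by move=> /(_ 0%MM); rewrite -mpolyC1 msupp1 inE eqxx weight0 => /(_ isT).
by apply: (@weight_ideal_valuation _ 0 0) => // m.
Qed.

Definition edge_mnm (F : {set 'I_n}) : 'X_{1..n} := [multinom (i \in F : nat) | i < n].

Lemma edge_mnmE F : 'X_[edge_mnm F] = \prod_(i in F) 'X_i :> {mpoly K[n]}.
Proof.
rewrite mpolyXE_id [RHS]big_mkcond; apply: eq_bigr => i _.
by rewrite mnmE; case: (i \in F).
Qed.

Lemma weight_edge t F : weight t (edge_mnm F) = (\sum_(v in F) t v)%N.
Proof.
rewrite /weight [RHS]big_mkcond; apply: eq_bigr => v _.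
by rewrite mnmE; case: (v \in F); rewrite ?muln1 ?muln0.
Qed.

Variable E : {set {set 'I_n}}.

Lemma edge_ideal_weight t h :
  (forall F, F \in E -> h <= \sum_(v in F) t v)%N ->
  edge_ideal K E `<=` weight_ideal t h.
Proof.
move=> Eh; apply: ideal_gen_min; first exact: weight_ideal_ideal.
move=> _ [F FE ->]; rewrite -edge_mnmE => m /mem_msuppXP <-.
by rewrite weight_edge Eh.
Qed.

Definition is_cover : pred {set 'I_n} :=
  fun C => [forall F in E, F :&: C != finset.set0].

Lemma prime_ideal_prod (R : comNzRingType) (P : set R) (I : finType) (A : {set I})
    (f : I -> R) :
  prime_ideal P -> P (\prod_(i in A) f i) -> exists2 i, i \in A & P (f i).
Proof.
move=> [_ P1 PM] Pf; apply: contrapT => /forall2NP no; move: Pf.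
apply: (big_ind (fun x => ~ P x)) => // [x y nx ny /PM[]//|i iA].
by case: (no i).
Qed.

(** Minimality gives each [v] in [C] an edge meeting [C] only in [v]. A prime [Q] between the two
    ideals contains a variable of that edge, and this variable belongs to [C], so it is ['X_v]. *)
Lemma minimal_cover_prime C :
  minset is_cover C -> minimal_primes (edge_ideal K E) (vertex_prime C).
Proof.
move=> /minsetP[/'forall_implyP coverC minC].
split; first exact: vertex_prime_prime.
  apply: edge_ideal_weight => F FE; have /set0Pn[v] := coverC F FE.
  by rewrite inE => /andP[vF vC]; rewrite (bigD1 v) //= vC.
move=> Q Qprime IQ QP; have [[Q0 QD QM] Q1 Qmul] := Qprime.
have XQ v : v \in C -> Q 'X_v.
  move=> vC.
  have /forall_inPn[F FE] : ~~ is_cover (C :\ v).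
    apply/negP => cov; have := minC _ cov (finset.subD1set C v) => /setP/(_ v).
    by rewrite !inE vC eqxx.
  rewrite negbK => /eqP FCv.
  have [|w wF Xw] := @prime_ideal_prod _ Q _ F (fun i => 'X_i) Qprime.
    by apply: IQ; apply: sub_ideal_gen; exists F.
  suff -> : v = w by [].
  have wC : w \in C.
    have := QP _ Xw U_(w)%MM; rewrite msuppX inE eqxx weight_set => /(_ isT).
    rewrite lt0n sum_nat_eq0; apply: contraR => wC; apply/forall_inP => i iC.
    by rewrite mnm1E; case: (w =P i) => // wi; rewrite wi iC in wC.
  apply/eqP; apply: contraT => vw.
  have : w \in F :&: (C :\ v) by rewrite !inE wF wC eq_sym vw.
  by rewrite FCv inE.
apply/seteqP; split=> // p pC.
rewrite [p]mpolyE big_seq; apply: ideal_sum => // m /pC.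
rewrite weight_set lt0n sum_nat_eq0 => /forall_inPn[v vC mv].
have -> : m = (U_(v) + (m - U_(v)))%MM.
  by apply/mnmP => i; rewrite mnmDE mnmBE mnm1E; case: (v =P i) => [<-|_]; lia.
rewrite mpolyXD -mul_mpolyC; apply: (QM).
by rewrite mulrC; apply: (QM); apply: XQ.
Qed.

Lemma symbolic_power_cover h p m (C : {set 'I_n}) :
  symbolic_power (edge_ideal K E) h p -> m \in msupp p -> is_cover C ->
  (h <= \sum_(v in C) m v)%N.
Proof.
move=> ph mp /minset_exists[D Dmin DC].
have := weight_ideal_pow (@subset_refl _ _) (ph _ (minimal_cover_prime Dmin)) mp.
rewrite weight_set mul1n => /leq_trans; apply.
rewrite [leqRHS](big_setID D) /= (finset.setIidPr DC) leq_addr //.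
Qed.

Lemma edges_dvd_ideal_pow m (s : seq {set 'I_n}) :
  {subset s <= E} ->
  (forall v, count (fun F : {set 'I_n} => v \in F) s <= m v)%N ->
  exists p, 'X_[m] = p * \prod_(x <- [seq 'X_[edge_mnm F] | F <- s]) x :> {mpoly K[n]}.
Proof.
move=> sE sm.
pose q : 'X_{1..n} := [multinom count (fun F : {set 'I_n} => i \in F) s | i < n].
exists 'X_[m - q].
have -> : \prod_(x <- [seq 'X_[edge_mnm F] | F <- s]) x = 'X_[q] :> {mpoly K[n]}.
  rewrite big_map -(big_morph _ (@mpolyXD n K) (@mpolyX0 n K)).
  congr 'X_[_]; apply/mnmP => i.
  rewrite mnm_sumE mnmE -sumn_count sumnE big_map.
  by apply: eq_bigr => F _; rewrite mnmE.
rewrite -mpolyXD; congr 'X_[_]; apply/mnmP => i; rewrite mnmDE mnmBE mnmE subnK //.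
Qed.

Lemma edge_in_ideal (s : seq {set 'I_n}) x :
  {subset s <= E} -> x \in [seq 'X_[edge_mnm F] | F <- s] -> edge_ideal K E x.
Proof.
move=> sE /mapP[F /sE FE ->]; apply: sub_ideal_gen; exists F => //.
exact: edge_mnmE.
Qed.

End Weights.

(** * Integral closure of monomials in terms of fractional covers *)

Lemma clear_denominators (I : finType) (t : I -> rat) :
  (forall i, 0 <= t i) ->
  exists D (tN : I -> nat), (0 < D)%N /\ forall i, t i * D%:R = (tN i)%:R.
Proof.
move=> t0; pose d i := `|denq (t i)|%N.
have td i : t i * (d i)%:R = `|numq (t i)|%N%:R.
  by rewrite !natr_absz !ger0_norm ?numq_ge0 ?denq_ge0 // -numqE.
exists (\prod_i d i)%N, (fun i => `|numq (t i)| * \prod_(j | j != i) d j)%N.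
split=> [|i]; first by apply: prodn_gt0 => i; rewrite absz_gt0 denq_neq0.
by rewrite (bigD1 i) //= !natrM mulrA td.
Qed.

Section Exponents.

Variables (K : fieldType) (n : nat) (E : {set {set 'I_n}}).

(** A fractional cover scaled by a common denominator [D] is an integral weight giving every edge at
    least [D], so the closure has order at least [D * h]. *)
Lemma integral_closure_cover_value h (p : {mpoly K[n]}) m :
  integral_closure (ideal_pow (edge_ideal K E) h) p -> m \in msupp p ->
  cover_value E m h%:R.
Proof.
move=> ph mp t [t0 tE]; have [D [tN [D0 tND]]] := clear_denominators t0.
have D0' : 0 < D%:R :> rat by rewrite ltr0n.
have EW : edge_ideal K E `<=` weight_ideal tN D.
  apply: edge_ideal_weight => F FE; rewrite -(ler_nat rat) natr_sum.
  under eq_bigr do rewrite -tND.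
  by rewrite -mulr_suml ler_peMl ?tE // ltW.
have := integral_closure_weight (weight_ideal_pow EW) ph mp.
rewrite -(ler_nat rat) natrM natr_sum => Dh.
rewrite -(ler_pM2l D0'); apply: le_trans Dh _.
rewrite mulr_sumr; apply: ler_sum => v _.
by rewrite natrM -tND mulrCA mulrA.
Qed.

(** A dual packing of value at least [k], scaled by a common denominator [N], is a multiset of at
    least [k * N] edges whose product divides ['X_[m] ^+ N]. *)
Lemma cover_value_integral k (m : 'X_{1..n}) :
  cover_value E m k%:R ->
  exists2 N, (0 < N)%N &
    ideal_pow (ideal_pow (edge_ideal K E) k) N ('X_[m] ^+ N : {mpoly K[n]}).
Proof.
move=> /packing_of_covers[w [w0 wE wm] wk].
have [N [wN [N0 wNE]]] := clear_denominators w0.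
exists N => //.
pose s := take (k * N) (flatten [seq nseq (wN F) F | F <- index_enum {set 'I_n}]).
have sE : {subset s <= E}.
  move=> F /mem_take/flattenP[_ /mapP[G _ ->]]; rewrite mem_nseq => /andP[wG /eqP ->].
  apply: contraLR wG => /wE wG; rewrite -leqNgt -(ler_nat rat) -wNE wG mul0r //.
have ss : size s = (k * N)%N.
  rewrite size_takel // size_flatten sumnE !big_map.
  rewrite -(ler_nat rat) natrM natr_sum.
  rewrite (eq_bigr (fun F => w F * N%:R)); last by move=> F _; rewrite size_nseq wNE.
  by rewrite -mulr_suml ler_wpM2r ?ler0n.
have sm v : (count (fun F : {set 'I_n} => v \in F) s <= (m *+ N)%MM v)%N.
  apply: (@leq_trans (\sum_(F : {set 'I_n} | v \in F) wN F)).
    apply: leq_trans (leq_count_subseq _ (take_subseq _ _)) _.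
    rewrite count_flatten sumnE !big_map [leqRHS]big_mkcond /=.
    by apply: leq_sum => F _; rewrite count_nseq; case: (v \in F); rewrite ?mul1n.
  rewrite -(ler_nat rat) natr_sum mulmnE natrM.
  under eq_bigr do rewrite -wNE.
  by rewrite -mulr_suml ler_wpM2r ?ler0n.
have [p mp] := edges_dvd_ideal_pow K sE sm.
rewrite mpolyXn mp mulrC; apply: (idealMr _ (ideal_pow_ideal _ _)).
apply: ideal_pow_pow => [x|]; last by rewrite size_map.
exact: edge_in_ideal.
Qed.

End Exponents.

(* [uphalf m] is the ceiling of m / 2. *)
Theorem theorem4p10 (K : fieldType) (n r : nat) (E : {set {set 'I_n}})
    (hr : (2 <= r)%N) (hE : hypergraph E) (hs : simple_hypergraph E) (hp : partite r E)
    (k : nat) (hk : (1 <= k)%N) :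
  integral_closure
      (ideal_pow (edge_ideal K E) ((r - 1) * (k - 1) + 1)%N)
    `<=` ideal_pow (edge_ideal K E) k /\
  symbolic_power (edge_ideal K E) (uphalf (r * (k - 1)) + 1)%N
    `<=` integral_closure (ideal_pow (edge_ideal K E) k).
Proof.
have [c cE] := partite_coloring hp.
split=> p pI; rewrite [p]mpolyE.
  rewrite big_seq; apply: ideal_sum => [|m mp]; first exact: ideal_pow_ideal.
  (* [integral_packing] at [k - 1] returns [k] edges. *)
  have mval : cover_value E m ((r%:R - 1) * (k - 1)%:R + 1).
    have := integral_closure_cover_value pI mp.
    by rewrite natrD natrM natrB //; apply: ltnW.
  have [s [ss sE sm]] := integral_packing hr hE cE mval.
  have [q ->] := edges_dvd_ideal_pow K sE sm.
  rewrite -mul_mpolyC mulrA mulrC; apply: (idealMr _ (ideal_pow_ideal _ _)).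
  have := ideal_pow_prod (fun x => @edge_in_ideal K n E s x sE).
  by rewrite size_map ss subn1 prednK.
have pE m : m \in msupp p -> exists2 N, (0 < N)%N &
    ideal_pow (ideal_pow (edge_ideal K E) k) N ('X_[m] ^+ N).
  move=> mp; apply: cover_value_integral; apply: lovasz_cover hr cE _ => C Ccov.
  (* The [+ 1] in the symbolic exponent provides the strict inequality on covers. *)
  rewrite -ltnS -addn1 ltnS; apply: symbolic_power_cover pI mp _.
  by apply/forall_inP.
rewrite big_seq (eq_bigr (fun m : 'X_{1..n} => (p@_m)%:MP * 'X_[m])) => [|m _]; last first.
  by rewrite mul_mpolyC.
exact: integral_closure_sum.
Qed.
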